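(* Let $G$ be a finite group. For any subgroup $Z$ of the center $Z(G)$ of $G$, $$\mu(G)=\prod_{\phi\in\mathrm{Irr}(Z)}\mu_\phi(G).$$
   Context: Let $G$ be a finite group. $\mathrm{Irr}$ denotes the set of irreducible complex characters, $\mathrm{Conj}(G)$ the set of conjugacy classes of $G$, and $C_G(g)$ the centralizer of $g$. The group algebra $\mathbb{C}G$ has basis $\{[g]\mid g\in G\}$ with $[g][h]=[gh]$; $[S]=\sum_{g\in S}[g]$ for $S\subset G$; $Z(\mathbb{C}G)$ is its center. Let $\overline{\sum_g c_g[g]}=\sum_g\overline{c_g}[g^{-1}]$, and for $u,v\in Z(\mathbb{C}G)$ let $\langle u|v\rangle=\mathrm{tr}_{Z(\mathbb{C}G)}(\overline{u}v)$, where $\mathrm{tr}_{Z(\mathbb{C}G)}(u)$ is the trace of $w\mapsto uw$ on $Z(\mathbb{C}G)$. For a finite ordered set $\mathcal{B}\subset Z(\mathbb{C}G)$ put $\gamma(\mathcal{B})=|\det(\langle u|v\rangle)_{u,v\in\mathcal{B}}|$. Let $\gamma(G)=\gamma(\{[K]\mid K\in\mathrm{Conj}(G)\})$, $c(G)=\prod_{K\in\mathrm{Conj}(G)}|C_G(g_K)|$ with $g_K\in K$, and $\mu(G)=\gamma(G)/c(G)$. Let $Z\le Z(G)$. $Z$ acts on $\mathrm{Conj}(G)$ by $(z,K)\mapsto zK$. The $Z$-orbits are indexed by the classes of $G/Z$: write $\mathrm{Conj}(G/Z)=\{\overline{K}_i\mid i\in I_{G/Z}\}$, choose $g_i\in G$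 whose image in $G/Z$ lies in $\overline{K}_i$, and let $K_i$ be the conjugacy class of $g_i$ in $G$; then $\{K_i\mid i\in I_{G/Z}\}$ is a complete set of representatives of the $Z$-orbits in $\mathrm{Conj}(G)$. For $K\in\mathrm{Conj}(G)$ let $\mathrm{Ann}_Z(K)=\{z\in Z\mid zK=K\}$, and for $N\le Z$ let $I(G:Z)_N=\{j\in I_{G/Z}\mid\mathrm{Ann}_Z(K_j)=N\}$. For $\phi\in\mathrm{Irr}(Z)$ put $e_\phi=\frac{1}{|Z|}\sum_{z\in Z}\overline{\phi(z)}[z]$, $\mathcal{B}(G)_\phi=\{e_\phi[K_j]\mid X\le\mathrm{Ker}\,\phi,\ j\in I(G:Z)_X\}$, $\gamma_\phi(G)=\gamma(\mathcal{B}(G)_\phi)$, $c_\phi(G)=\prod_{N\le\mathrm{Ker}\,\phi}\prod_{j\in I(G:Z)_N}|C_G(g_j)|\,|Z/N|^{-1}$, and $\mu_\phi(G)=\gamma_\phi(G)/c_\phi(G)$. (These numbers do not depend on the choices of the $g_i$.) *)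

(* Defs.v *)
From mathcomp Require Import all_boot all_order all_algebra all_fingroup.
From mathcomp Require Import all_solvable all_field all_character.

Set Implicit Arguments.
Unset Strict Implicit.
Unset Printing Implicit Defensive.

Import GroupScope Order.TTheory GRing.Theory Num.Theory.
Local Open Scope ring_scope.

(* Complex numbers are algC, over which the library's [irr] is defined.
   The group algebra is the library's [group_ring algC G]: the matrices
   spanned by [regular_repr algC G g], g \in G, which stand for the basis
   elements [g]; [gset_mx algC G S] is then the sum [S], and *m the product. *)
Section GroupAlgebra.

Variables (gT : finGroupType) (G : {group gT}).

Local Notation CG := 'M[algC]_(gcard G).
Local Notation ZCG := ('Z(group_ring algC G))%MS.

Definition gring_coef (u : CG) (x : gT) : algC := gring_proj x u 0 0.

Definition gring_bar (u : CG) : CG :=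
  \sum_(x in G) (gring_coef u x)^* *: regular_repr algC G x^-1%g.

(* The rows of [row_base ZCG] are a basis of the center, [lin_mulmx u] maps
   each row w to u w, and [pinvmx] reads off coordinates in that basis.
   Meaningful only when u is in the center. *)
Definition center_trace (u : CG) : algC :=
  \tr (row_base ZCG *m lin_mulmx u *m pinvmx (row_base ZCG)).

Definition center_form (u v : CG) : algC := center_trace (gring_bar u *m v).

Definition gamma_of (B : seq CG) : algC :=
  `|\det (\matrix_(i < size B, j < size B) center_form B`_i B`_j)|.

Definition gamma : algC :=
  gamma_of [seq gset_mx algC G K | K : {set gT} <- enum (classes G)].

Definition cent_prod : algC :=
  \prod_(K in classes G) #|'C_G[repr K]|%:R.

Definition mu : algC := gamma / cent_prod.

End GroupAlgebra.

Section CentralSubgroup.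

Variables (gT : finGroupType) (G Z : {group gT}).

(* The index set I_{G/Z} is [classes (G / Z)] itself. *)
Definition class_lifts (g : {set coset_of Z} -> gT) : Prop :=
  forall k, k \in classes (G / Z) -> g k \in G /\ coset Z (g k) \in k.

Definition Ann (K : {set gT}) : {set gT} := [set z in Z | (z *: K)%g == K].

Variable g : {set coset_of Z} -> gT.

Definition lift_class (k : {set coset_of Z}) : {set gT} := g k ^: G.

Definition index_Ann (N : {set gT}) : {set {set coset_of Z}} :=
  [set k in classes (G / Z) | Ann (lift_class k) == N].

Variable phi : Iirr Z.

Definition char_idem : 'M[algC]_(gcard G) :=
  #|Z|%:R^-1 *: \sum_(z in Z) ('chi_phi z)^* *: regular_repr algC G z.

(* The listed elements are pairwise distinct: they are nonzero, with
   supports over distinct classes of G / Z. *)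
Definition basis_phi : seq 'M[algC]_(gcard G) :=
  [seq char_idem *m gset_mx algC G (lift_class k)
  | X : {group gT} <- enum [pred X : {group gT} | X \subset cfker 'chi_phi],
    k : {set coset_of Z} <- enum (index_Ann X)].

Definition gamma_phi : algC := gamma_of basis_phi.

Definition cent_prod_phi : algC :=
  \prod_(N : {group gT} | N \subset cfker 'chi_phi)
    \prod_(k in index_Ann N) (#|'C_G[g k]|%:R * #|(Z / N)%g|%:R^-1).

Definition mu_phi : algC := gamma_phi / cent_prod_phi.

End CentralSubgroup.

(* Main.v *)
Require Import Defs.
From mathcomp Require Import all_boot all_order all_algebra all_fingroup.
From mathcomp Require Import all_solvable all_field all_character.
From mathcomp Require Import ring.
Set Implicit Arguments.
Unset Strict Implicit.
Unset Printing Implicit Defensive.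
Import GroupScope Order.TTheory GRing.Theory Num.Theory.
Local Open Scope ring_scope.

(** Both sides of the identity can be computed in closed form from the
    character table.

    The center of the group algebra is a product of copies of the complex
    numbers, one for each irreducible character chi, the projections being the
    central modes omega_chi. So the trace of multiplication by a central u is
    the sum of all omega_chi(u) ([center_trace_omega]). Since bar acts on the
    modes as complex conjugation, the Gram matrix of a family B of central
    elements is Om^* Om with Om = (omega_chi(b)). When B has as many elements as
    there are characters that do not vanish on it, Om is square, and if
    moreover omega_chi(b) = c_b x(chi, b) / chi(1) with x column-orthogonal of
    column norms e_b, then
      gamma(B) = prod_b c_b^2 e_b / prod_chi chi(1)^2
    ([gamma_of_orthogonal]).

    For the class sums, c is the size of the class, x is the character table
    and e is the centralizer order, which is exactly what c(G) cancels:
      mu(G) = prod_K |K|^2 / prod_chi chi(1)^2   ([mu_degree]).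

    By Schur's lemma each chi restricts to Z as chi(1) times a single linear
    character, its central character, and omega_chi(e_phi) is 1 or 0 according
    to whether that character is phi. Averaging column orthogonality over Z
    shows that the columns g_j with Ann_Z(K_j) <= Ker phi remain orthogonal
    when only the chi over phi are kept, with norm |C_G(g_j)| / |Z : Ann_Z(K_j)|
    ([orthogonality_over]). This is what c_phi(G) cancels, so
      mu_phi(G) = prod_j |K_j|^2 / prod_(chi over phi) chi(1)^2
    ([mu_phi_degree]). The square shape is obtained by counting: orthogonality
    gives one inequality for each phi, and both sides add up to the number of
    classes of G ([size_over]).

    In the product over phi every chi occurs once in the denominators. In the
    numerators |K_j|^2 occurs once for each phi trivial on Ann_Z(K_j), that is
    |Z : Ann_Z(K_j)| times, which is the number of classes in the Z-orbit of
    K_j; all of these have the same size ([big_classes_orbits]). *)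

(** * Central modes and the trace form *)

Lemma mulmx1C_cast (R : comUnitRingType) m n (A : 'M[R]_(m, n)) (B : 'M_(n, m)) :
  m = n -> A *m B = 1%:M -> B *m A = 1%:M.
Proof. by move=> e; case: n / e A B => A B; apply: mulmx1C. Qed.

Section CenterOfGroupAlgebra.

Variables (gT : finGroupType) (G : {group gT}).

Local Notation CG := 'M[algC]_(gcard G).
Local Notation ZCG := ('Z(group_ring algC G))%MS.
Local Notation aG := (regular_repr algC G).
Implicit Types (u v : CG) (i : Iirr G).

Lemma center_mulmx u v : (u \in ZCG)%MS -> (v \in ZCG)%MS -> (u *m v \in ZCG)%MS.
Proof.
move=> /center_mxP[Ru cu] /center_mxP[Rv cv]; apply/center_mxP.
split=> [|w Rw]; first exact: envelop_mxM.
by rewrite mulmxA cu // -!mulmxA cv.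
Qed.

Lemma class_sum_center K : K \in classes G -> (gset_mx algC G K \in ZCG)%MS.
Proof.
by move=> clK; rewrite -(enum_rankK_in clK clK) gring_class_sum_central.
Qed.

Lemma omega_class_sum i x : x \in G ->
  'omega_i[gset_mx algC G (x ^: G)] = #|x ^: G|%:R * 'chi_i x / 'chi_i 1%g.
Proof.
move=> Gx; have clK := mem_classes Gx.
rewrite -[in LHS](enum_rankK_in clK clK) (@gring_mode_class_sum_eq _ _ _ _ x) //.
by rewrite enum_rankK_in ?class_refl.
Qed.

Lemma gset_mx1 z : gset_mx algC G [set z] = aG z.
Proof. by rewrite /gset_mx big_set1. Qed.

Lemma central_class z : z \in 'Z(G) -> [set z] \in classes G.
Proof.
case/centerP=> Gz cz; suff <-: z ^: G = [set z] by apply: mem_classes.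
apply/eqP; rewrite eqEsubset sub1set class_refl andbT.
apply/subsetP=> _ /imsetP[y Gy ->].
by rewrite inE conjgE (cz y Gy) mulKg.
Qed.

Lemma xcfun_coef (phi : 'CF(G)) u :
  phi.[u]%CF = \sum_(x in G) gring_coef u x * phi x.
Proof.
rewrite /xcfun mxE [RHS]big_enum_val /=.
apply: eq_bigr => k _.
by rewrite /gring_coef /gring_proj !mxE gring_valK.
Qed.

(** The coefficient of [x] in u is conjugated and moved to [x^-1], where chi
    takes the conjugate value. *)
Lemma omega_bar i u : 'omega_i[gring_bar u] = ('omega_i[u])^*.
Proof.
rewrite unlock !xcfunZl rmorphM fmorphV /= (conj_natr (Cnat_irr1 i)).
congr (_ * _); rewrite (xcfun_coef _ u) rmorph_sum raddf_sum /=.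
apply: eq_bigr => x Gx; rewrite xcfunZr xcfunG ?groupV // rmorphM /=.
by rewrite char_inv ?irr_char.
Qed.

Lemma gring_coef_gset_mx (K : {set gT}) x :
  K \subset G -> x \in G -> gring_coef (gset_mx algC G K) x = (x \in K)%:R.
Proof.
move=> /subsetP sKG Gx; rewrite /gring_coef /gset_mx linear_sum summxE.
rewrite (eq_bigr (fun y => (y == x)%:R)) => [|y Ky]; last first.
  rewrite /= gring_projE // ?(sKG y) // eq_sym.
  by case: eqP => _; rewrite mxE.
have [Kx | notKx] := boolP (x \in K).
  by rewrite (bigD1 x) //= eqxx big1 ?addr0 // => y /andP[_ /negPf->].
by rewrite big1 // => y Ky; case: eqP Ky notKx => // -> ->.
Qed.

(** Expand u over the class sums: bar sends the sum over a class to the sum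
    over the inverse class. *)
Lemma bar_center u : (u \in ZCG)%MS -> (gring_bar u \in ZCG)%MS.
Proof.
rewrite -classg_base_center => /submxP[a]; rewrite mulmx_sum_row => Du.
have {Du} -> : u = \sum_k a 0 k *: gset_mx algC G (enum_val k).
  apply: (can_inj mxvecK); rewrite Du linear_sum; apply: eq_bigr => k _.
  by rewrite linearZ rowK.
have barE (k : 'I_#|classes G|) : gring_bar (gset_mx algC G (enum_val k)) =
              gset_mx algC G (enum_val k : {set gT})^-1%g.
  have /imsetP[y Gy ->] := enum_valP k.
  have sKG: y ^: G \subset G := class_subG Gy (subxx G).
  rewrite [RHS]/gset_mx [RHS](reindex_inj invg_inj) /=.
  rewrite /gring_bar (bigID [in y ^: G]) /= [X in _ + X]big1 ?addr0
    => [|x]; last first.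
    by case/andP=> Gx /negPf notKx;
      rewrite gring_coef_gset_mx // notKx conjC0 scale0r.
  rewrite (eq_bigl [in y ^: G]) => [|x]; last first.
    by rewrite andb_idl // => /(subsetP sKG).
  apply: eq_big => [x | x Kx]; first by rewrite inE invgK.
  by rewrite gring_coef_gset_mx ?(subsetP sKG) // Kx conjC1 scale1r.
have -> : gring_bar (\sum_k a 0 k *: gset_mx algC G (enum_val k)) =
    \sum_k (a 0 k)^* *: gring_bar (gset_mx algC G (enum_val k)).
  under [RHS]eq_bigr do rewrite scaler_sumr.
  rewrite exchange_big; apply: eq_bigr => x Gx /=.
  rewrite /gring_coef !linear_sum summxE rmorph_sum scaler_suml /=.
  by apply: eq_bigr => k _; rewrite linearZ mxE rmorphM scalerA.
rewrite linear_sum summx_sub // => k _; rewrite linearZ scalemx_sub // barE.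
have /imsetP[y Gy ->] := enum_valP k.
by rewrite -classVg class_sum_center ?mem_classes ?groupV.
Qed.

(** The modes diagonalize multiplication by u: if M is its matrix in the given
    basis and Om the matrix of the modes of the basis vectors, then
    M Om = Om D with D diagonal. Column orthogonality of the characters makes
    Om invertible, so M and D have the same trace. *)
Lemma center_trace_omega u :
  (u \in ZCG)%MS -> center_trace u = \sum_i 'omega_i[u].
Proof.
move=> Zu; rewrite /center_trace; set R := row_base ZCG; set M := _ *m _ *m _.
have row_center k : (vec_mx (row k R) \in ZCG)%MS.
  by rewrite vec_mxK (submx_trans (row_sub k R)) // eq_row_base.
have MR : M *m R = R *m lin_mulmx u.
  rewrite mulmxKpV // eq_row_base; apply/row_subP=> k; rewrite row_mul.
  by rewrite -[row k R]vec_mxK mul_vec_lin center_mulmx.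
pose Om := \matrix_(k, i) 'omega_i[vec_mx (row k R)].
pose D := diag_mx (\row_i 'omega_i[u]).
have MOm : M *m Om = Om *m D.
  apply/matrixP=> k i; rewrite mul_mx_diag !mxE mulrC -gring_irr_modeM //.
  have <- : vec_mx (row k M *m R) = u *m vec_mx (row k R).
    rewrite -row_mul MR row_mul -[X in X *m lin_mulmx u]vec_mxK mul_vec_lin.
    by rewrite mxvecK.
  rewrite mulmx_sum_row !raddf_sum /=; apply: eq_bigr => l _.
  by rewrite linearZ xcfunZr !mxE.
(* P changes basis to the class sums, whose modes are known explicitly. *)
pose P := classg_base algC G *m pinvmx R.
have PR : P *m R = classg_base algC G.
  by rewrite mulmxKpV // eq_row_base classg_base_center.
(* Up to scaling, the conjugate transpose of the character table. *)
pose Psi := \matrix_(i < Nirr G, k < #|classes G|)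
  (('chi[G]_i (repr (enum_val k : {set gT})))^* * 'chi_i 1%g / #|G|%:R).
have inv1 : P *m (Om *m Psi) = 1%:M.
  rewrite mulmxA.
  have -> : P *m Om = \matrix_(k, i) 'omega_i[gset_mx algC G (enum_val k)].
    apply/matrixP=> k i; rewrite !mxE.
    have <- : vec_mx (row k P *m R) = gset_mx algC G (enum_val k).
      by rewrite -row_mul PR rowK mxvecK.
    rewrite mulmx_sum_row !raddf_sum; apply: eq_bigr => l _.
    by rewrite /= linearZ xcfunZr !mxE.
  apply/matrixP=> k l; rewrite !mxE.
  have [Gk Dk] := repr_classesP (enum_valP k);
    have [Gl Dl] := repr_classesP (enum_valP l).
  transitivity (#|enum_val k|%:R / #|G|%:R * (\sum_i 'chi[G]_i (repr (enum_val k)) *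
      ('chi_i (repr (enum_val l)))^*)).
    rewrite mulr_sumr; apply: eq_bigr => i _.
    rewrite !mxE {1}Dk omega_class_sum // -Dk.
    have := irr1_neq0 i; have := neq0CG G; move: ('chi_i 1%g) => d nG nd.
    by field; rewrite nG.
  rewrite second_orthogonality_relation // (sameP class_eqP eqP) -Dk -Dl.
  rewrite (inj_eq enum_val_inj) -(Lagrange (subsetIl G 'C[repr (enum_val k)])).
  rewrite index_cent1 -Dk natrM.
  have := neq0CG 'C_G[repr (enum_val k)]; have : #|enum_val k|%:R != 0 :> algC.
    by rewrite Dk -index_cent1 pnatr_eq0 -lt0n indexg_gt0.
  by case: (k == l) => nK nC; rewrite ?mulr0 //=; field; rewrite nK nC.
have rankZ : \rank ZCG = #|classes G|.
  by rewrite -classg_base_center (eqnP (classg_base_free _ _)).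
have inv2 := mulmx1C_cast (esym rankZ) inv1.
have inv3 : Psi *m P *m Om = 1%:M.
  by apply: mulmx1C_cast; rewrite ?rankZ ?NirrE // mulmxA.
transitivity (\tr (M *m Om *m (Psi *m P))).
  by rewrite -mulmxA (mulmxA Om) inv2 mulmx1.
rewrite MOm -mulmxA mxtrace_mulC -mulmxA inv3 mulmx1 mxtrace_diag.
by apply: eq_bigr => i _; rewrite mxE.
Qed.

End CenterOfGroupAlgebra.

(** * Gram determinants of orthogonal families *)

Section GramDeterminant.

Variables (gT : finGroupType) (G : {group gT}).

Local Notation CG := 'M[algC]_(gcard G).
Local Notation ZCG := ('Z(group_ring algC G))%MS.

Lemma center_form_omega (u v : CG) : (u \in ZCG)%MS -> (v \in ZCG)%MS ->
  center_form u v = \sum_(i : Iirr G) ('omega_i[u])^* * 'omega_i[v].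
Proof.
move=> Zu Zv; rewrite /center_form center_trace_omega ?center_mulmx ?bar_center //.
by apply: eq_bigr => i _; rewrite gring_irr_modeM ?bar_center // omega_bar.
Qed.

Lemma gamma_ofE n (B : seq CG) : size B = n ->
  gamma_of B = `|\det (\matrix_(i < n, j < n) center_form B`_i B`_j)|.
Proof. by move<-. Qed.

(** The Gram matrix is Om^* Om, where Om = diag(1 / chi(1)) X diag(c) is
    square because [size s = size t], and X^* X = diag(e). *)
Lemma gamma_of_orthogonal (I : eqType) (s : seq (Iirr G)) (t : seq I)
    (b : I -> CG) (x : Iirr G -> I -> algC) (c e : I -> algC) :
    uniq s -> uniq t -> size s = size t ->
    {in t, forall k, (b k \in ZCG)%MS} ->
    {in t, forall k i,
       'omega_i[b k] = if i \in s then c k * x i k / 'chi_i 1%g else 0} ->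
    {in t &, forall k l,
       \sum_(i <- s) (x i k)^* * x i l = if k == l then e k else 0} ->
  gamma_of [seq b k | k <- t] =
    (\prod_(k <- t) (`|c k| ^+ 2 * `|e k|)) / \prod_(i <- s) 'chi_i 1%g ^+ 2.
Proof.
move=> Us Ut st Zb omb orth; pose n := size t.
have sz_s : size s == n by rewrite st.
pose S := Tuple sz_s; pose T := in_tuple t.
pose X := \matrix_(a < n, j < n) x (tnth S a) (tnth T j).
pose D := diag_mx (\row_(a < n) ('chi_(tnth S a) 1%g)^-1).
pose C := diag_mx (\row_(j < n) c (tnth T j)).
pose Om := D *m X *m C.
have Tin j : tnth T j \in t by apply: mem_tnth.
rewrite (@gamma_ofE n) ?size_map //.
have -> : \matrix_(j < n, l < n) center_form [seq b k | k <- t]`_j [seq b k | k <- t]`_l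
    = (map_mx Num.conj Om)^T *m Om.
  apply/matrixP=> j l; rewrite !mxE.
  have bE (h : 'I_n) : [seq b k | k <- t]`_h = b (tnth T h).
    by rewrite (nth_map (tnth T h)) //; congr b; apply/esym/tnth_nth.
  rewrite !bE center_form_omega ?Zb //.
  have OmE a h : Om a h = 'omega_(tnth S a)[b (tnth T h)].
    by rewrite omb // mem_tnth /Om mul_mx_diag mul_diag_mx !mxE; ring.
  under [RHS]eq_bigr do rewrite [_^T _ _]mxE [map_mx _ _ _ _]mxE !OmE.
  rewrite -(big_tuple _ _ S xpredT
    (fun i => ('omega_i[b (tnth T j)])^* * 'omega_i[b (tnth T l)])).
  rewrite (big_uniq _ Us) /= [LHS](bigID [in s]) /= [X in _ + X]big1
    ?addr0 // => i /negPf i_s.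
  by rewrite !omb // i_s mulr0.
have detX : `|\det X| ^+ 2 = \prod_(k <- t) `|e k|.
  have : (map_mx Num.conj X)^T *m X = diag_mx (\row_(j < n) e (tnth T j)).
    apply/matrixP=> j l; rewrite !mxE.
    under eq_bigr do rewrite !mxE.
    rewrite -(big_tuple _ _ S xpredT (fun i => (x i (tnth T j))^* * x i (tnth T l))).
    rewrite orth // (inj_eq (tuple_uniqP T Ut)).
    by case: eqP.
  move/(congr1 (fun A => `|\det A|)); rewrite det_mulmx det_tr det_map_mx det_diag.
  rewrite normrM norm_conjC -expr2 => ->; rewrite normr_prod (big_tuple _ _ T).
  by apply: eq_bigr => j _; rewrite mxE.
rewrite det_mulmx det_tr det_map_mx normrM norm_conjC -expr2.
rewrite /Om !det_mulmx !det_diag !normrM !exprMn detX.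
have -> : `|\prod_(a < n) (\row_a (('chi_(tnth S a)) 1%g)^-1) 0 a| ^+ 2 =
    (\prod_(i <- s) 'chi_i 1%g ^+ 2)^-1.
  rewrite -prodfV (big_tuple _ _ S) normr_prod -prodrXl; apply: eq_bigr => a _.
  by rewrite mxE normfV exprVn ger0_norm // char1_ge0 ?irr_char.
have -> : `|\prod_(j < n) (\row_j c (tnth T j)) 0 j| ^+ 2 =
  \prod_(k <- t) `|c k| ^+ 2.
  rewrite (big_tuple _ _ T) normr_prod -prodrXl; apply: eq_bigr => a _.
  by rewrite mxE.
by rewrite [X in _ = X / _]big_split /=; ring.
Qed.

End GramDeterminant.

(** * Orbits of Z on the conjugacy classes *)

Section OrbitsOfClasses.

Variables (gT : finGroupType) (G Z : {group gT}).
Hypothesis sZ : Z \subset 'Z(G).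

Let sZG : Z \subset G. Proof. exact: subset_trans sZ (center_sub G). Qed.
Let cGZ : Z \subset 'C(G). Proof. exact: subset_trans sZ (subsetIr G 'C(G)). Qed.
Let nZG : G \subset 'N(Z). Proof. by rewrite cents_norm // centsC. Qed.

Lemma lcoset_class z x : z \in Z -> x \in G -> (z *: (x ^: G) = (z * x) ^: G)%g.
Proof.
move=> Zz Gx; have cz := centP (subsetP cGZ z Zz).
rewrite -lcosetE /lcoset -imset_comp; apply: eq_in_imset => y Gy /=.
by rewrite conjMg [in RHS]conjgE (cz y Gy) mulKg.
Qed.

Lemma rcoset_class z x : z \in Z -> x \in G -> ((x ^: G) :* z = (z * x) ^: G)%g.
Proof.
move=> Zz Gx; rewrite -lcoset_class // centC //.
rewrite (subset_trans (class_subG Gx (subxx G))) // centsC sub1set.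
exact: subsetP cGZ z Zz.
Qed.

Lemma quotient_mulZ z x : z \in Z -> x \in G -> ((z * x) ^: G / Z = x ^: G / Z)%g.
Proof.
move=> Zz Gx; have [Gz nG] := (subsetP sZG z Zz, subsetP nZG).
have [nz nx] := (nG z Gz, nG x Gx).
by rewrite !quotient_class ?groupM // morphM //= coset_id // mul1g.
Qed.

Lemma quotient_class_eqP x y : x \in G -> y \in G ->
  reflect (exists2 z, z \in Z & x ^: G = (z * y) ^: G)%g
          (x ^: G / Z == y ^: G / Z)%g.
Proof.
move=> Gx Gy; apply: (iffP eqP) => [eqxy | [z Zz ->]]; last exact: quotient_mulZ.
have: coset Z x \in (y ^: G / Z)%g.
  by rewrite -eqxy mem_morphim ?class_refl ?(subsetP nZG).
case/morphimP=> w nw /[dup] yGw /imsetP[h Gh Dw] /rcoset_kercosetP.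
move=> /(_ (subsetP nZG x Gx) nw) /rcosetP[z Zz ->].
have Gw : w \in G by rewrite Dw groupJ.
by exists z => //; rewrite -!lcoset_class // (class_eqP yGw).
Qed.

Lemma orbit_class x : x \in G ->
  orbit 'Rs%act Z (x ^: G) = [set K in classes G | K / Z == x ^: G / Z]%g.
Proof.
move=> Gx; apply/setP=> K; rewrite inE; apply/orbitP/andP=> [[z Zz <-] | []].
  rewrite /= rcosetE rcoset_class // quotient_mulZ // eqxx.
  by rewrite mem_classes // groupM // (subsetP sZG).
case/imsetP=> y Gy -> /quotient_class_eqP[] // z Zz ->.
by exists z => //=; rewrite rcosetE rcoset_class.
Qed.

(** Since Z is central, left multiplication of classes agrees with right
    multiplication, so the annihilator is a point stabilizer, hence a group to
    which the orbit-stabilizer theorem applies. *)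
Lemma Ann_astab1 x : x \in G -> Ann Z (x ^: G) = 'C_Z[x ^: G | 'Rs]%g.
Proof.
move=> Gx; apply/setP=> z; rewrite !inE /=; case Zz: (z \in Z) => //=.
by rewrite sub1set inE /= rcosetE rcoset_class // lcoset_class.
Qed.

Lemma card_orbit_class x : x \in G ->
  #|[set K in classes G | K / Z == x ^: G / Z]%g| = #|Z : Ann Z (x ^: G)|.
Proof. by move=> Gx; rewrite Ann_astab1 // -card_orbit orbit_class. Qed.

(** These characters are the inflations of those of the abelian group Z / N. *)
Lemma card_Iirr_cfker (N : {group gT}) : N \subset Z ->
  #|[set phi : Iirr Z | N \subset cfker 'chi_phi]| = #|Z : N|.
Proof.
move=> sNZ; have abZ : abelian Z by rewrite /abelian (subset_trans cGZ) ?centS.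
have nsNZ : N <| Z by rewrite -sub_abelian_normal.
rewrite -card_quotient ?normal_norm // -card_Iirr_abelian ?quotient_abelian //.
rewrite cardsE -(on_card_preimset (mod_Iirr_bij nsNZ)).
by apply: eq_card => i; rewrite !inE mod_IirrE ?cfker_mod.
Qed.

Variable g : {set coset_of Z} -> gT.
Hypothesis lift_g : class_lifts G g.

Definition index_ker (phi : Iirr Z) : {set {set coset_of Z}} :=
  [set k in classes (G / Z) | Ann Z (lift_class G g k) \subset cfker 'chi_phi].

Lemma lift_in_G k : k \in classes (G / Z) -> g k \in G.
Proof. by case/lift_g. Qed.

Lemma lift_class_quotient k : k \in classes (G / Z) -> (lift_class G g k / Z)%g = k.
Proof.
move=> clk; have [Gg kg] := lift_g clk.
rewrite quotient_class ?(subsetP nZG) //; case/imsetP: clk kg => x _ -> kg.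
exact/class_eqP.
Qed.

(** The Z-orbit of the class K lifted from k is the fibre of G -> G / Z over k.
    It has |Z : Ann K| elements, as many as there are characters of Z trivial
    on Ann K, that is, indices phi for which k occurs on the right. *)
Lemma big_classes_orbits (R : Type) (idx : R) (op : Monoid.com_law idx)
    (F : {set gT} -> R) :
    {in Z & G, forall z x, F ((z * x) ^: G)%g = F (x ^: G)} ->
  \big[op/idx]_(K in classes G) F K =
    \big[op/idx]_(phi : Iirr Z)
      \big[op/idx]_(k in index_ker phi) F (lift_class G g k).
Proof.
move=> FZ.
rewrite (partition_big (fun K => K / Z)%g [in classes (G / Z)]) /=; last first.
  by move=> K clK; rewrite classes_quotient // imset_f.
under [RHS]eq_bigr do rewrite big_set big_mkcondr /=.
rewrite [RHS]exchange_big /=; apply: eq_bigr => k clk; rewrite -big_mkcond /=.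
have Gk := lift_in_G clk.
transitivity (\big[op/idx]_(K in [set K in classes G | K / Z == g k ^: G / Z]%g)
    F (lift_class G g k)).
  have Dk : (g k ^: G / Z)%g = k := lift_class_quotient clk.
  rewrite big_set Dk; apply: eq_bigr => K /andP[]; rewrite -[X in _ == X]Dk.
  by case/imsetP=> x Gx -> /quotient_class_eqP[] // z Zz ->; apply: FZ.
rewrite !big_const card_orbit_class // Ann_astab1 // -card_Iirr_cfker ?subsetIl //.
by rewrite cardsE.
Qed.

End OrbitsOfClasses.

(** * Degree formulas for mu *)

(** Column orthogonality: the norm of the column of K is the factor of K in
    [cent_prod]. *)
Lemma mu_degree (gT : finGroupType) (G : {group gT}) :
  mu G = (\prod_(K in classes G) #|K|%:R ^+ 2) / \prod_(i : Iirr G) 'chi_i 1%g ^+ 2.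
Proof.
rewrite /mu /gamma (@gamma_of_orthogonal _ _ _ (index_enum (Iirr G)) _ _
  (fun i K => 'chi_i (repr K)) (fun K => #|K|%:R) (fun K => #|'C_G[repr K]|%:R)).
- have nzC : \prod_(K in classes G) #|'C_G[repr K]|%:R != 0 :> algC.
    by apply/prodf_neq0 => K _; rewrite neq0CG.
  rewrite /cent_prod big_enum big_split /=.
  rewrite (eq_bigr (fun K : {set gT} => #|K|%:R ^+ 2))
    => [|K _]; last by rewrite normr_nat.
  rewrite [X in _ * X / _ / _](eq_bigr (fun K : {set gT} => #|'C_G[repr K]|%:R))
    => [|K _]; last by rewrite normr_nat.
  by rewrite mulrAC mulfK // big_mkcond.
- exact: index_enum_uniq.
- exact: enum_uniq.
- by rewrite -cardE -NirrE -[RHS]card_ord cardT enumT.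
- by move=> K; rewrite mem_enum; apply: class_sum_center.
- move=> K; rewrite mem_enum => clK i; rewrite mem_index_enum;
    have [Gr DK] := repr_classesP clK.
  by rewrite {1}DK omega_class_sum // -DK.
move=> K L; rewrite !mem_enum => /repr_classesP[GK DK] /repr_classesP[GL DL].
under eq_bigr do rewrite mulrC.
rewrite second_orthogonality_relation // mulrb (sameP class_eqP eqP) -DL -DK eq_sym.
by case: (K =P L) => [-> | ].
Qed.

Section CentralCharacters.

Variables (gT : finGroupType) (G Z : {group gT}).
Hypothesis sZ : Z \subset 'Z(G).

Local Notation ZCG := ('Z(group_ring algC G))%MS.
Local Notation aG := (regular_repr algC G).

Let sZG : Z \subset G. Proof. exact: subset_trans sZ (center_sub G). Qed.

Definition central_char (i : Iirr G) : Iirr Z :=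
  cfIirr (('chi_i 1%g)^-1 *: 'Res[Z] 'chi_i).

(** Z lies in the center of chi, on which chi is a multiple of a linear
    character. *)
Lemma central_charE i : 'Res[Z] 'chi_i = 'chi_i 1%g *: 'chi_(central_char i).
Proof.
have [xi lin_xi Dxi] := cfcenter_Res 'chi_i.
have sZc : Z \subset ('Z('chi_i))%CF.
  by rewrite (subset_trans sZ) // -(cap_cfcenter_irr G) bigcap_inf.
have DZ : 'Res[Z] 'chi_i = 'chi_i 1%g *: 'Res[Z] xi.
  by rewrite -linearZ -Dxi /= cfResRes ?cfcenter_sub.
have irr_xi : ('chi_i 1%g)^-1 *: 'Res[Z] 'chi_i \in irr Z.
  by rewrite DZ scalerK ?irr1_neq0 // lin_char_irr ?cfRes_lin_char.
by rewrite cfIirrE // scalerA mulfV ?irr1_neq0 // scale1r.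
Qed.

Lemma central_elt_center z : z \in Z -> (aG z \in ZCG)%MS.
Proof.
by move=> Zz; rewrite -gset_mx1 class_sum_center // central_class // (subsetP sZ).
Qed.

Lemma omega_central i z : z \in Z -> 'omega_i[aG z] = 'chi_(central_char i) z.
Proof.
move=> Zz; have Gz := subsetP sZG z Zz.
rewrite unlock xcfunZl xcfunG // -(cfResE _ sZG Zz) central_charE cfunE.
by rewrite mulKf ?irr1_neq0.
Qed.

(** A central z acts on the representation affording chi as the scalar
    omega_chi([z]). *)
Lemma irr_central_mul i z x : z \in Z -> x \in G ->
  'chi_i (z * x)%g = 'chi_(central_char i) z * 'chi_i x.
Proof.
move=> Zz Gx; have Gz := subsetP sZG z Zz.
rewrite -!(xcfunG 'chi_i) ?groupM // repr_mxM // -irrRepr !xcfun_repr.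
rewrite gring_opM ?envelop_mx_id // irr_gring_center ?central_elt_center //.
by rewrite omega_central // mul_scalar_mx mxtraceZ.
Qed.

Lemma char_idem_center (phi : Iirr Z) : (char_idem G phi \in ZCG)%MS.
Proof.
rewrite linearZ scalemx_sub // linear_sum summx_sub // => z Zz.
by rewrite linearZ scalemx_sub ?central_elt_center.
Qed.

(** The mode of e_phi is the inner product of the central character of chi
    with phi. *)
Lemma omega_char_idem i (phi : Iirr Z) :
  'omega_i[char_idem G phi] = (central_char i == phi)%:R.
Proof.
rewrite xcfunZr raddf_sum /= -cfdot_irr cfdotE; congr (_ * _);
  apply: eq_bigr => z Zz.
by rewrite xcfunZr omega_central // mulrC.
Qed.

Variable g : {set coset_of Z} -> gT.
Hypothesis lift_g : class_lifts G g.

(** The inner product of phi with the central character of chi detects the chi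
    over phi. Expanding it over Z turns the partial sum into an average over z
    of full column products of g_l with z g_k. These vanish unless z g_k is
    conjugate to g_l; this forces k = l, and then z in Ann(K_k), where phi is
    trivial. *)
Lemma orthogonality_over (phi : Iirr Z) k l :
    k \in index_ker G g phi -> l \in index_ker G g phi ->
  \sum_(i | central_char i == phi) ('chi_i (g k))^* * 'chi_i (g l) =
  if k == l then #|'C_G[g k]|%:R * #|Z : Ann Z (lift_class G g k)|%:R^-1 else 0.
Proof.
rewrite !inE => /andP[clk kerk] /andP[cll _].
have Gk := lift_in_G lift_g clk; have Gl := lift_in_G lift_g cll.
transitivity (\sum_(i : Iirr G) '['chi_phi, 'chi_(central_char i)] *
   (('chi_i (g k))^* * 'chi_i (g l))).
  rewrite big_mkcond; apply: eq_bigr => i _; rewrite cfdot_irr eq_sym.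
  by case: eqP => _; rewrite ?mul1r ?mul0r.
transitivity (#|Z|%:R^-1 * \sum_(z in Z) 'chi_phi z *
    \sum_(i : Iirr G) 'chi_i (g l) * ('chi_i (z * g k)%g)^*).
  under [in RHS]eq_bigr do rewrite mulr_sumr.
  rewrite exchange_big mulr_sumr; apply: eq_bigr => i _ /=.
  rewrite cfdotE -mulrA mulr_suml; congr (_ * _); apply: eq_bigr => z Zz.
  by rewrite irr_central_mul // rmorphM /=; ring.
under eq_bigr => z Zz.
  rewrite second_orthogonality_relation ?groupM ?(subsetP sZG z Zz) //; over.
have [eq_kl | neq_kl] := eqVneq k l; last first.
  rewrite big1 ?mulr0 // => z Zz; rewrite mulrb.
  case: ifP => [/class_eqP lk|]; last by rewrite mulr0.
  case/eqP: neq_kl; rewrite -(lift_class_quotient sZ lift_g clk).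
  by rewrite -(lift_class_quotient sZ lift_g cll) /lift_class lk (quotient_mulZ sZ).
rewrite -eq_kl (bigID [in Ann Z (lift_class G g k)]) /= [X in _ + X]big1 ?addr0.
  rewrite (eq_bigr (fun=> #|'C_G[g k]|%:R)) => [|z /andP[Zz Az]]; last first.
    rewrite (cfker1 (subsetP kerk z Az)) lin_char1 ?mul1r; last first.
      by apply/char_abelianP;
        rewrite /abelian (subset_trans sZ) // subIset // centS ?orbT.
    move: Az; rewrite inE Zz /= (lcoset_class sZ) // => /eqP ->.
    by rewrite class_refl.
  rewrite (eq_bigl [in Ann Z (lift_class G g k)])
    => [|z]; last by rewrite inE; case: (z \in Z).
  rewrite sumr_const -mulr_natl /lift_class (Ann_astab1 sZ) //.
  rewrite -[in #|Z|%:R](Lagrange (subsetIl Z 'C[g k ^: G | 'Rs])) natrM.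
  by field; rewrite neq0CG natr_indexg_neq0.
move=> z /andP[Zz]; rewrite inE Zz (lcoset_class sZ) //= mulrb.
by case: ifP => [/class_eqP<-|]; rewrite ?eqxx ?mulr0.
Qed.

(** Orthogonal nonzero columns are independent, so the left side is at most the
    right one for every phi. Summing over phi gives the number of classes of G
    on both sides, hence equality throughout. *)
Lemma size_over (phi : Iirr Z) :
  #|index_ker G g phi| = #|[set i | central_char i == phi]|.
Proof.
have le_phi (psi : Iirr Z)
    : (#|index_ker G g psi| <= #|[set i | central_char i == psi]|)%N.
  pose J := index_ker G g psi; pose S := [set i | central_char i == psi].
  pose X := \matrix_(a < #|S|, k < #|J|) 'chi_(enum_val a) (g (enum_val k)).
  pose Y := \matrix_(k < #|J|, a < #|S|) ('chi_(enum_val a) (g (enum_val k)))^*.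
  have YX : Y *m X = diag_mx (\row_k
      (#|'C_G[g (enum_val k)]|%:R *
       #|Z : Ann Z (lift_class G g (enum_val k))|%:R^-1)).
    apply/matrixP=> k l; rewrite !mxE.
    under eq_bigr do rewrite !mxE.
    have := orthogonality_over (enum_valP k) (enum_valP l).
    rewrite (inj_eq enum_val_inj) -mulrb => <-.
    rewrite -(big_enum_val
      (fun i => ('chi_i (g (enum_val k)))^* * 'chi_i (g (enum_val l)))).
    by rewrite big_set.
  have : \rank (Y *m X) = #|J|.
    apply: mxrank_unit; rewrite YX unitmxE det_diag unitfE.
    apply/prodf_neq0 => k _; rewrite mxE mulf_neq0 ?neq0CG //.
    have := enum_valP k; rewrite inE => /andP[/(lift_in_G lift_g) Gk _].
    by rewrite invr_eq0 /lift_class (Ann_astab1 sZ) // natr_indexg_neq0.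
  by move <-; rewrite (leq_trans (mxrankM_maxr _ _)) ?rank_leq_row.
have := leqif_sum (fun psi (_ : true) => leqif_eq (le_phi psi)).
move/geq_leqif; rewrite -[X in (X <= _)%N](_ : #|classes G| = _).
rewrite -[X in (_ <= X)%N](_ : #|classes G| = _) ?leqnn.
- by move/esym/forallP/(_ phi)/eqP.
- rewrite -sum1_card (big_classes_orbits sZ lift_g) //.
  by apply: eq_bigr => psi _; rewrite sum1_card.
rewrite -NirrE -[LHS]card_ord -sum1_card (partition_big central_char xpredT) //=.
by apply: eq_bigr => psi _; rewrite -sum1_card; apply: eq_bigl => i; rewrite inE.
Qed.

(** The list [basis_phi] runs through the subgroups X of Ker phi and then the k
    with annihilator X; as each k has only one annihilator, this enumerates
    [index_ker] without repetition. *)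
Lemma mu_phi_degree (phi : Iirr Z) :
  mu_phi G g phi = (\prod_(k in index_ker G g phi) #|lift_class G g k|%:R ^+ 2) /
    \prod_(i | central_char i == phi) 'chi_i 1%g ^+ 2.
Proof.
pose Ns := enum [pred X : {group gT} | X \subset cfker 'chi_phi].
pose t := [seq k | X : {group gT} <- Ns,
                   k : {set coset_of Z} <- enum (index_Ann G g X)].
have tE k : (k \in t) = (k \in index_ker G g phi).
  apply/allpairsPdep/idP => [[X [h [NX hX ->]]] | ].
    move: NX hX; rewrite !mem_enum !inE => kerX /andP[-> /eqP ->]; exact: kerX.
  rewrite inE => /andP[clk kerk]; have Gk := lift_in_G lift_g clk.
  exists 'C_Z[g k ^: G | 'Rs]%G, k.
  by rewrite !mem_enum !inE clk /= -(Ann_astab1 sZ Gk) kerk eqxx.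
have Ut : uniq t.
  apply: allpairs_uniq_dep
    => [||u v]; [exact: enum_uniq | by move=> *; apply: enum_uniq | ].
  move=> /allpairsPdep[X [k [_ kX ->]]] /allpairsPdep[Y [l [_ lY ->]]] /= Ekl.
  rewrite Ekl; congr existT; apply: val_inj; move: kX lY;
    rewrite Ekl !mem_enum !inE /=.
  by case/andP=> _ /eqP-> /andP[_ /eqP->].
have perm_t : perm_eq t (enum (index_ker G g phi)).
  by apply: uniq_perm => // [|k]; rewrite ?enum_uniq ?tE ?mem_enum.
have abZ : abelian Z by rewrite /abelian (subset_trans sZ) // subIset // centS ?orbT.
have big_t (F : {set coset_of Z} -> algC) :
    \prod_(k <- t) F k = \prod_(k in index_ker G g phi) F k.
  by rewrite -big_enum; apply: perm_big.
rewrite /mu_phi /gamma_phi.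
have -> : basis_phi G g phi =
  [seq char_idem G phi *m gset_mx algC G (lift_class G g k) | k <- t].
  by rewrite map_allpairs.
pose e k : algC := #|'C_G[g k]|%:R * #|Z : Ann Z (lift_class G g k)|%:R^-1.
have cent_prodE : cent_prod_phi G g phi = \prod_(k in index_ker G g phi) e k.
  rewrite -big_t big_allpairs_dep /= big_enum; apply: eq_bigr => N _.
  rewrite big_enum; apply: eq_bigr => k; rewrite inE => /andP[clk /eqP DN].
  rewrite /e DN card_quotient // sub_abelian_norm // -DN.
  by apply/subsetP=> z; rewrite inE => /andP[].
rewrite cent_prodE.
rewrite (@gamma_of_orthogonal _ _ _ (enum [set i | central_char i == phi]) _ _
  (fun i k => 'chi_i (g k)) (fun k => #|lift_class G g k|%:R) e) //.
- rewrite big_t big_split /= big_enum /=.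
  rewrite (eq_bigr (fun k => #|lift_class G g k|%:R ^+ 2))
    => [|k _]; last by rewrite normr_nat.
  rewrite [X in _ * X / _ / _](eq_bigr e)
    => [|k _]; last by rewrite ger0_norm ?divr_ge0 ?ler0n.
  rewrite mulrAC mulfK; first by congr (_ / _); apply: eq_bigl => i; rewrite inE.
  apply/prodf_neq0 => k /setIdP[clk _]; rewrite mulf_neq0 ?neq0CG // invr_eq0.
  by rewrite /lift_class (Ann_astab1 sZ) ?natr_indexg_neq0 ?(lift_in_G lift_g).
- exact: enum_uniq.
- by rewrite -cardE -size_over (perm_size perm_t) -cardE.
- move=> k; rewrite tE => /setIdP[clk _].
  by rewrite center_mulmx ?char_idem_center ?class_sum_center ?mem_classes
    ?(lift_in_G lift_g).
- move=> k; rewrite tE => /setIdP[clk _] i; have Gk := lift_in_G lift_g clk.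
  rewrite gring_irr_modeM ?char_idem_center ?class_sum_center ?mem_classes //.
  rewrite omega_char_idem omega_class_sum // mem_enum inE.
  by case: eqP; rewrite ?mul1r ?mul0r.
move=> k l; rewrite !tE => kerk kerl;
  rewrite -(orthogonality_over kerk kerl) big_enum.
by apply: eq_bigl => i; rewrite inE.
Qed.

End CentralCharacters.

Theorem theorem3p4 (gT : finGroupType) (G Z : {group gT})
    (sZ : Z \subset 'Z(G))
    (g : {set coset_of Z} -> gT) (lift_g : class_lifts G g) :
  mu G = \prod_(phi : Iirr Z) mu_phi G g phi.
Proof.
under eq_bigr do rewrite mu_phi_degree //.
rewrite mu_degree [RHS]big_split /= [X in _ = _ * X]prodfV; congr (_ / _).
  apply: (big_classes_orbits sZ lift_g) => z x Zz Gx.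
  by rewrite -(lcoset_class sZ) // card_lcoset.
by rewrite (partition_big (@central_char _ G Z) xpredT).
Qed.
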